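(* Assume $\mathbb{E}[\sup_{i\in\mathbb{N}_0}Z_{\tau_i}^{\alpha}]\le B^{\alpha}$ for some $B>0$ and $\alpha>1$. For any fixed tolerance level $\varepsilon>0$, there exists a finite $K\in\mathbb{N}$ such that $$Y_0^{(K)}\le Y_0^{(\infty)}\le Y_0^{(K)}+\varepsilon.$$
   Context: $\mathbb{N}=\{1,2,\dots\}$, $\mathbb{N}_0=\mathbb{N}\cup\{0\}$. $(\Omega,\mathcal{F},\mathbb{F},\mathbb{P})$ is a filtered probability space with $\mathbb{F}=(\mathcal{F}_t)_{0\le t\le\infty}$ satisfying the usual conditions. $(\tau_i)_{i\in\mathbb{N}_0}$ is a sequence of $\mathbb{F}$-stopping times with, a.s., $\tau_0=0$, $\tau_i<\tau_{i+1}<\infty$ for all $i\in\mathbb{N}_0$, and $\lim_{i\to\infty}\tau_i=\infty$. $T\in(0,\infty)$ is a fixed horizon. $Z=(Z_t)_{0\le t<\infty}$ is a non-negative $\mathbb{F}$-adapted process, càdlàg on $[0,T]$, such that almost surely $Z_t=0$ for all $t>T$. For $K\in\mathbb{N}\cup\{\infty\}$, let $\mathcal{T}_K(\omega):=\{\tau_i(\omega): i\in\mathbb{N}_0,\ i\le K\}$ and $$Y_0^{(K)}:=\sup\left\{\mathbb{E}[Z_{\mathfrak{t}}] : \mathfrak{t}\text{ an } \mathbb{F}\text{-stopping time with } \mathfrak{t}(\omega)\in\mathcal{T}_K(\omega)\text{ a.s.}\right\}.$$ Equivalently, $Y_0^{(K)}=\sup\mathbb{E}[Z_{\tau_{\mathfrak{n}}}]$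 over all $\mathfrak{n}:\Omega\to\mathbb{N}_0$ with $\mathfrak{n}\le K$ and $\{\mathfrak{n}=i\}\in\mathcal{F}_{\tau_i}$ for all $i\in\mathbb{N}_0$. *)

(* Defs.v *)
From HB Require Import structures.
From mathcomp Require Export all_boot all_order all_algebra.
From mathcomp Require Export all_classical all_reals all_analysis.

Set Implicit Arguments.
Unset Strict Implicit.
Unset Printing Implicit Defensive.

Import Order.TTheory GRing.Theory Num.Theory numFieldNormedType.Exports.
Local Open Scope classical_set_scope.
Local Open Scope ring_scope.
Local Open Scope ereal_scope.

Section FilteredSpace.
Context {d : measure_display} {Omega : measurableType d} {R : realType}.
Variable P : probability Omega R.

(* The time set is [0, +oo], encoded as the nonnegative part of [\bar R];
   [F t] is irrelevant for [t < 0]. *)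
Definition is_filtration (F : \bar R -> set (set Omega)) : Prop :=
  [/\ forall t, 0 <= t -> sigma_algebra setT (F t),
      forall t, 0 <= t -> F t `<=` measurable
    & forall s t, 0 <= s -> s <= t -> F s `<=` F t].

(* Since [F 0] consists of measurable sets, the second clause also makes the
   underlying probability space complete. *)
Definition usual_conditions (F : \bar R -> set (set Omega)) : Prop :=
  [/\ is_filtration F,
      P.-negligible `<=` F 0
    & forall t, 0 <= t -> t < +oo -> F t = \bigcap_(s in [set s | t < s]) F s].

Definition stopping_time (F : \bar R -> set (set Omega))
    (tau : Omega -> \bar R) : Prop :=
  (forall w, 0 <= tau w) /\
  (forall t, 0 <= t -> F t [set w | tau w <= t]).

(* A process is a map [Z : R -> Omega -> R]; [Z t] is irrelevant for
   [t < 0]. *)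
Definition adapted (F : \bar R -> set (set Omega)) (Z : R -> Omega -> R) :
    Prop :=
  forall t : R, (0 <= t)%R ->
  forall A : set R, measurable A -> F t%:E (Z t @^-1` A).

(* No right-continuity at the right endpoint [T]. *)
Definition cadlag_on (T : R) (x : R -> R) : Prop :=
  (forall t : R, (0 <= t < T)%R -> x s @[s --> t^'+] --> x t) /\
  (forall t : R, (0 < t <= T)%R -> cvg (x s @[s --> t^'-])).

(* The processes considered vanish after a finite horizon, whence the
   convention that the value at time [+oo] is 0. *)
Definition stopped_value (Z : R -> Omega -> R) (tau : Omega -> \bar R)
    (w : Omega) : R :=
  if tau w is r%:E then Z r w else 0%R.

(* [Some k] bounds the index by [k], [None] stands for [K = oo]. *)
Definition exercise_times (tau : nat -> Omega -> \bar R) (K : option nat)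
    (w : Omega) : set (\bar R) :=
  [set tau i w | i in [set i | if K is Some k then (i <= k)%N else true]].

Definition optimal_value (F : \bar R -> set (set Omega))
    (tau : nat -> Omega -> \bar R) (Z : R -> Omega -> R) (K : option nat) :
    \bar R :=
  ereal_sup [set 'E_P[stopped_value Z sigma] | sigma in
    [set sigma | stopping_time F sigma /\
                 {ae P, forall w, exercise_times tau K w (sigma w)}]].

End FilteredSpace.

(* Main.v *)
Require Import Defs.
From mathcomp Require Import all_boot all_order all_algebra.
From mathcomp Require Import all_classical all_reals all_analysis.
From mathcomp Require Import measurable_realfun.
Import Order.TTheory GRing.Theory Num.Theory numFieldNormedType.Exports.
Local Open Scope classical_set_scope.
Local Open Scope ring_scope.
Local Open Scope ereal_scope.

(* Given an admissible sigma, stop at rho = min(sigma, tau_K), which is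
   admissible for K. The two payoffs differ only where sigma > tau_K; there
   Z_sigma vanishes unless tau_K <= T, and is at most 1 + G with
   G = sup_i Z_{tau_i}^alpha because x <= 1 + x^alpha. Hence
   E[Z_sigma] <= E[Z_rho] + E[(1 + G) 1_{tau_K <= T}], and the last term does
   not depend on sigma and tends to 0 by dominated convergence, as tau_K tends
   to infinity. *)

(** * Stopping times and adapted processes *)

Lemma sigma_algebra_setU {T : Type} (G : set (set T)) (A B : set T) :
  sigma_algebra setT G -> G A -> G B -> G (A `|` B).
Proof.
move=> [G0 _ GU] GA GB; rewrite -bigcup2E; apply: GU => i.
by rewrite /bigcup2; case: ifP => // _; case: ifP.
Qed.

Lemma stopping_time_min {d} {Omega : measurableType d} {R : realType}
    (F : \bar R -> set (set Omega)) (sigma rho : Omega -> \bar R) :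
  is_filtration F -> stopping_time F sigma -> stopping_time F rho ->
  stopping_time F (fun w => mine (sigma w) (rho w)).
Proof.
move=> [Fsigma _ _] [s0 Fs] [r0 Fr]; split=> [w|t t0].
  by rewrite le_min s0 r0.
rewrite (_ : [set w | _] = [set w | sigma w <= t] `|` [set w | rho w <= t]).
  by apply: sigma_algebra_setU; [exact: Fsigma|exact: Fs|exact: Fr].
apply/seteqP; split=> w /=; rewrite ge_min; first by move/orP.
by move=> h; apply/orP.
Qed.

Lemma stopping_time_measurable {d} {Omega : measurableType d} {R : realType}
    (F : \bar R -> set (set Omega)) (sigma : Omega -> \bar R) :
  is_filtration F -> stopping_time F sigma -> measurable_fun setT sigma.
Proof.
move=> [_ Fmeas _] [s0 Fs] mT.
apply: (measurability _ (ErealGenOInfty.measurableE R)) => //.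
move=> _ [_ [x ->] <-]; rewrite setTI.
rewrite (_ : _ @^-1` _ = ~` [set w | sigma w <= x%:E]); last first.
  by apply/seteqP; split=> w /=; rewrite in_itv/= andbT ltNge => /negP.
(* The filtration is meaningful only at nonnegative times. For [x < 0] the sublevel set is empty, as
   [sigma] is nonnegative. *)
apply: measurableC; have [x0|x0] := leP 0%R x.
  by apply: (Fmeas x%:E); rewrite ?lee_fin//; apply: Fs; rewrite lee_fin.
rewrite (_ : [set w | _] = set0)//; apply/seteqP; split=> w //= wx.
by have := le_trans (s0 w) wx; rewrite lee_fin leNgt x0.
Qed.

Lemma adapted_measurable {d} {Omega : measurableType d} {R : realType}
    (F : \bar R -> set (set Omega)) (Z : R -> Omega -> R) (t : R) :
  is_filtration F -> adapted F Z -> (0 <= t)%R -> measurable_fun setT (Z t).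
Proof.
move=> [_ Fmeas _] adZ t0 _ A mA; rewrite setTI.
by apply: (Fmeas t%:E); [rewrite lee_fin|exact: adZ].
Qed.

(** * Measurability of the stopped payoff *)

Lemma usual_conditions_complete {d} {Omega : measurableType d} {R : realType}
    (P : probability Omega R) (F : \bar R -> set (set Omega)) :
  usual_conditions P F -> measure_is_complete P.
Proof. by move=> [[_ Fmeas _] F0 _] N /F0; exact: Fmeas. Qed.

(** A countably valued index cuts each preimage into countably many measurable pieces. This makes
    [Z] measurable when evaluated at a random point of a deterministic grid. *)
Lemma measurable_fun_nat_index {d d'} {T : measurableType d}
    {U : measurableType d'} (k : T -> nat) (h : nat -> T -> U) :
  measurable_fun setT k -> (forall m, measurable_fun setT (h m)) ->
  measurable_fun setT (fun x => h (k x) x).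
Proof.
move=> mk mh _ A mA; rewrite setTI.
rewrite (_ : _ @^-1` _ =
    \bigcup_m (k @^-1` [set m] `&` h m @^-1` A)); last first.
  by apply/seteqP; split=> x /=; [move=> Ax; exists (k x)|case=> m _ [/= ->]].
apply: bigcup_measurable => m _; apply: measurableI.
  by rewrite -[X in measurable X]setTI; apply: mk.
by rewrite -[X in measurable X]setTI; apply: mh.
Qed.

Lemma measurable_truncn {R : realType} :
  measurable_fun [set: R] (fun x => Num.truncn x).
Proof.
move=> _ A _; rewrite setTI.
(* The guard [0 < m] reflects that truncation sends every negative real to 0, so the fibre over 0 is
   unbounded below. *)
rewrite (_ : _ @^-1` _ = \bigcup_(m in A)
    ([set x | (x < m.+1%:R)%R] `\` [set x | (x < m%:R)%R && (0 < m)%N])).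
  apply: bigcup_measurable => m _; apply: measurableD.
    rewrite (_ : [set x | _] = [set` `]-oo, m.+1%:R[%R]); first exact: measurable_itv.
    by apply/seteqP; split=> x; rewrite /= in_itv.
  case: m => [|m].
    under eq_set do rewrite ltnn andbF.
    rewrite (_ : [set _ | _] = set0); first exact: measurable0.
    by apply/seteqP; split=> x /=.
  rewrite (_ : [set x | _] = [set` `]-oo, m.+1%:R[%R]); first exact: measurable_itv.
  by apply/seteqP; split=> x; rewrite /= in_itv/= andbT.
have key (x : R) m : Num.truncn x = m <->
    (x < m.+1%:R)%R /\ ~ ((x < m%:R)%R && (0 < m)%N).
  rewrite -truncn_le_nat; case: m => [|m].
    rewrite ltnn andbF leqn0; split=> [->|[/eqP]]//.
  rewrite -truncn_le_nat ltn0Sn andbT; split=> [->|[a /negP b]].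
    by rewrite leqnn ltnn.
  by apply/eqP; rewrite eqn_leq a ltnNge b.
apply/seteqP; split=> x /=.
  move=> Ax; exists (Num.truncn x) => //.
  exact/key.
by move=> [m Am /= /key ->].
Qed.

(** The successor in the numerator keeps the grid point strictly above [t] even when [t] lies on the
    grid, as a limit along [t^'+] requires; the overshoot is at most [1 / n.+1]. *)
Lemma truncn_grid_cvg {R : realType} (t : R) : (0 <= t)%R ->
  let grid n := ((Num.truncn (n.+1%:R * t)).+1%:R / n.+1%:R)%R in
  (forall n, (t < grid n)%R) /\ grid @ \oo --> t.
Proof.
move=> t0 grid.
have lt_grid n : (t < grid n)%R.
  by rewrite ltr_pdivlMr// mulrC truncnS_gt.
split=> //; apply: (@squeeze_cvgr _ _ _ _ (cst t) (fun n => t + n.+1%:R^-1)%R).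
- near=> n; rewrite (ltW (lt_grid n))/=.
  rewrite ler_pdivrMr// mulrDl mulVf// -natr1 lerD2r mulrC truncn_le.
  by rewrite mulr_ge0.
- exact: cvg_cst.
- by rewrite -[X in _ --> X]addr0; apply: cvgD; [exact: cvg_cst|exact: cvg_harmonic].
Unshelve. all: by end_near.
Qed.

(* On {sigma < T}, Z_sigma is the limit of the values of Z at discretizations
   of sigma from above; the identity holds only almost surely, so completeness
   of P is needed. *)
Lemma stopped_value_measurable {d} {Omega : measurableType d} {R : realType}
    (P : probability Omega R) (F : \bar R -> set (set Omega))
    (T : R) (Z : R -> Omega -> R) (sigma : Omega -> \bar R) :
  usual_conditions P F -> (0 <= T)%R -> adapted F Z ->
  {ae P, forall w, cadlag_on T (Z ^~ w)} ->
  {ae P, forall w, forall t : R, (T < t)%R -> Z t w = 0%R} ->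
  stopping_time F sigma ->
  measurable_fun setT (stopped_value Z sigma).
Proof.
move=> hF T0 adZ cadZ Z0 st.
have Ffil : is_filtration F by case: hF.
have ms := stopping_time_measurable _ _ Ffil st.
apply/measurable_EFinP.
pose t n w : R := ((Num.truncn (n.+1%:R * fine (sigma w))).+1%:R / n.+1%:R)%R.
(* The case [sigma w = T] is kept apart: right-continuity may fail at [T], and grid points beyond
   [T] would give 0 instead of [Z T w]. In the first branch [sigma w] is finite, so [fine] loses
   nothing. *)
pose f n w := (if (sigma w < T%:E)%E then Z (t n w) w
   else if (T%:E < sigma w)%E then 0%R else Z T w)%:E.
have mf n : measurable_fun setT (f n).
  apply/measurable_EFinP.
  have ml : measurable_fun setT (fun w => sigma w < T%:E).
    exact: measurable_fun_lte.
  have ml' : measurable_fun setT (fun w => T%:E < sigma w).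
    exact: measurable_fun_lte.
  apply: measurable_fun_ifT => //; last first.
    by apply: measurable_fun_ifT => //; exact: (adapted_measurable F).
  apply: (measurable_fun_nat_index
    (fun w => Num.truncn (n.+1%:R * fine (sigma w))%R)
    (fun m w => Z (m.+1%:R / n.+1%:R)%R w)) => [|m].
    apply: (measurableT_comp measurable_truncn).
    apply: measurable_funM => //.
    exact: measurableT_comp.
  by apply: (adapted_measurable F) => //; rewrite divr_ge0.
(* The upper limit is measurable whether or not [f] converges, and it equals the stopped value
   wherever the path properties hold. *)
apply: (ae_measurable_fun (usual_conditions_complete _ _ hF)
  (f := fun w => limn_esup (f ^~ w))); last exact: measurable_fun_limn_esup.
apply: filterS2 cadZ Z0 => w cad Zw0 _ /=.
suff fcvg : f ^~ w @ \oo --> (stopped_value Z sigma w)%:E.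
  by rewrite is_cvg_limn_esupE; [exact/cvg_lim|apply/cvg_ex; exists (stopped_value Z sigma w)%:E].
have := st.1 w; rewrite /f /t /stopped_value.
case: (sigma w) => [r| |] //=; last first.
  by move=> _; rewrite ltry; exact: cvg_cst.
rewrite !lte_fin lee_fin => r0; case: (ltgtP r T) => rT.
- apply/fine_cvgP; split; first by near=> n.
  have := cad.1 r; rewrite r0 rT => /(_ isT) Zr.
  exact: (cvg_at_rightP _ _ _).1 Zr _ (truncn_grid_cvg _ r0).
- by rewrite Zw0//; exact: cvg_cst.
- by rewrite rT; exact: cvg_cst.
Unshelve. all: by end_near.
Qed.

(** * The dominating variable and its tail integrals *)

Lemma stopped_value_ge0 {d} {Omega : measurableType d} {R : realType}
    (Z : R -> Omega -> R) (sigma : Omega -> \bar R) (w : Omega) :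
  (forall t : R, (0 <= t)%R -> (0 <= Z t w)%R) -> 0 <= sigma w ->
  (0 <= stopped_value Z sigma w)%R.
Proof. by rewrite /stopped_value; case: (sigma w) => // r Z0; exact: Z0. Qed.

Lemma ler1D_powR {R : realType} (x a : R) :
  (0 <= x)%R -> (1 <= a)%R -> (x <= 1 + x `^ a)%R.
Proof.
move=> x0 a1; have [x1|/ltW x1] := leP x 1%R.
  by rewrite (le_trans x1)// lerDl powR_ge0.
by rewrite (le_trans (le1r_powR x1 a1))// lerDr.
Qed.

Lemma measurable_ereal_sup_range {d} {Omega : measurableType d} {R : realType}
    (f : nat -> Omega -> \bar R) :
  (forall n, measurable_fun setT (f n)) ->
  measurable_fun setT (fun w => ereal_sup (range (f ^~ w))).
Proof.
move=> mf; rewrite (_ : (fun w => _) = (fun w => esups (f ^~ w) 0%N)).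
  exact: measurable_fun_esups.
apply/funext => w; rewrite /esups; congr ereal_sup.
by apply/seteqP; split=> _ [n _ <-]; exists n.
Qed.

(** Almost every point eventually leaves [A n], so the restrictions of [h] to [A n] tend to 0 almost
    everywhere, dominated by the absolute value of [h]. *)
Lemma integral_vanishing_sets_cvg0 {d} {Omega : measurableType d}
    {R : realType} (mu : {measure set Omega -> \bar R})
    (h : Omega -> \bar R) (A : nat -> set Omega) :
  mu.-integrable setT h -> (forall n, measurable (A n)) ->
  {ae mu, forall w, \forall n \near \oo, ~ A n w} ->
  \int[mu]_(w in A n) h w @[n --> \oo] --> 0.
Proof.
move=> ih mA Aout; have mh := measurable_int _ ih.
under eq_fun do rewrite integral_mkcond.
have [//|||||_ _] := @dominated_convergence _ _ _ mu setT measurableT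
    (fun n => h \_ (A n)) (cst 0) (fun w => `|h w|).
- move=> n; apply/(measurable_restrictT _ _).1 => //.
  exact: measurable_funTS.
- exact: measurable_cst.
- apply: filterS Aout => w Aw _; apply: cvg_near_cst.
  by apply: filterS Aw => n Anw; rewrite patchN// notin_setE.
- exact: integrable_abse.
- apply: aeW => w n _; rewrite /patch; case: ifP => // _.
  by rewrite abse0.
by rewrite integral0.
Qed.

(** * Stopping at [tau K] *)

(** Along an increasing sequence, the minimum of [tau i w] and [tau K w] is the term whose index is
    the smaller of [i] and [K]. *)
Lemma exercise_times_min {d} {Omega : measurableType d} {R : realType}
    (tau : nat -> Omega -> \bar R) (K : nat) (sigma : Omega -> \bar R)
    (w : Omega) :
  (forall i, tau i w < tau i.+1 w) ->
  exercise_times tau None w (sigma w) ->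
  exercise_times tau (Some K) w (mine (sigma w) (tau K w)).
Proof.
move=> tau_lt [i _ <-].
have tau_le : {homo tau^~ w : i j / (i <= j)%N >-> i <= j}.
  by apply/nondecreasing_seqP => j; exact/ltW.
have [iK|Ki] := leqP i K.
  by exists i => //; rewrite min_l// tau_le.
by exists K => //=; rewrite min_r// tau_le// ltnW.
Qed.

Lemma stopped_value_le_min {d} {Omega : measurableType d} {R : realType}
    (Z : R -> Omega -> R) (tau : nat -> Omega -> \bar R) (K : nat)
    (sigma : Omega -> \bar R) (T alpha : R) (w : Omega) :
  (forall i, 0 <= tau i w) ->
  (forall t : R, (0 <= t)%R -> (0 <= Z t w)%R) ->
  (forall t : R, (T < t)%R -> Z t w = 0%R) -> (1 <= alpha)%R ->
  exercise_times tau None w (sigma w) ->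
  (stopped_value Z sigma w)%:E <=
    (stopped_value Z (fun w => mine (sigma w) (tau K w)) w)%:E +
    ((fun w => 1 + ereal_sup (range (fun i =>
       ((stopped_value Z (tau i) w) `^ alpha)%:E)))
      \_ [set w | tau K w <= T%:E]) w.
Proof.
move=> tau_ge0 Zge0 Z0 alpha1 [i _ tau_sigma].
have G0 : 0 <= ereal_sup (range (fun i =>
    ((stopped_value Z (tau i) w) `^ alpha)%:E)).
  by apply: ereal_sup_ge; exists ((stopped_value Z (tau 0%N) w) `^ alpha)%:E;
    [exists 0%N|rewrite lee_fin powR_ge0].
have [sK|Ks] := leP (sigma w) (tau K w).
  rewrite {2}/stopped_value min_l// leeDl// /patch; case: ifP => // _.
  by rewrite adde_ge0.
rewrite /patch; case: ifPn => [_|]; last first.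
  rewrite notin_setE/= => /negP; rewrite -ltNge => TK.
  (* Here [sigma w] exceeds [T]: a finite value gives 0 by [Z0], and [+oo] gives 0 by convention. *)
  have -> : stopped_value Z sigma w = 0%R.
    by move: (lt_trans TK Ks); rewrite /stopped_value; case: (sigma w).
  (* Off its set the restriction takes the default [point], which is 0 in the extended reals. *)
  rewrite /point/= adde0 lee_fin; apply: stopped_value_ge0 => //.
  by rewrite le_min -tau_sigma !tau_ge0.
(* The payoff at the minimum is only bounded below by 0; the second term alone dominates, since
   [sigma w] is some [tau i w]. *)
rewrite -[leLHS]add0e; apply: leeD.
  rewrite lee_fin; apply: stopped_value_ge0 => //.
  by rewrite le_min -tau_sigma !tau_ge0.
have -> : stopped_value Z sigma w = stopped_value Z (tau i) w.
  by rewrite /stopped_value tau_sigma.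
apply: (@le_trans _ _ (1 + (stopped_value Z (tau i) w) `^ alpha)%:E).
  rewrite lee_fin; apply: ler1D_powR => //.
  exact: stopped_value_ge0.
by rewrite EFinD leeD2l// ereal_sup_ubound//; exists i.
Qed.

Theorem lemma12 (R : realType) (d : measure_display) (Omega : measurableType d)
    (P : probability Omega R) (F : \bar R -> set (set Omega))
    (hF : usual_conditions P F)
    (tau : nat -> Omega -> \bar R)
    (tau_stop : forall i, stopping_time F (tau i))
    (tau0 : {ae P, forall w, tau 0%N w = 0})
    (tau_incr : {ae P, forall w, forall i, tau i w < tau i.+1 w < +oo})
    (tau_lim : {ae P, forall w, tau i w @[i --> \oo] --> +oo})
    (T : R) (T_gt0 : (0 < T)%R)
    (Z : R -> Omega -> R)
    (Z_ge0 : forall (t : R) (w : Omega), (0 <= t)%R -> (0 <= Z t w)%R)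
    (Z_adapted : adapted F Z)
    (Z_cadlag : {ae P, forall w, cadlag_on T (Z ^~ w)})
    (Z_after : {ae P, forall w, forall t : R, (T < t)%R -> Z t w = 0%R})
    (B alpha : R) (B_gt0 : (0 < B)%R) (alpha_gt1 : (1 < alpha)%R)
    (Z_moment :
       \int[P]_w ereal_sup
         (range (fun i : nat => ((stopped_value Z (tau i) w) `^ alpha)%:E))
       <= (B `^ alpha)%:E)
    (eps : R) (eps_gt0 : (0 < eps)%R) :
  exists K : nat, (0 < K)%N /\
    optimal_value P F tau Z (Some K) <= optimal_value P F tau Z None /\
    optimal_value P F tau Z None <= optimal_value P F tau Z (Some K) + eps%:E.
Proof.
have Ffil : is_filtration F by case: hF.
have mZ sigma : stopping_time F sigma ->
    measurable_fun setT (stopped_value Z sigma).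
  by apply: (stopped_value_measurable P F T) => //; exact: ltW.
pose G w := ereal_sup
  (range (fun i : nat => ((stopped_value Z (tau i) w) `^ alpha)%:E)).
have mG : measurable_fun setT G.
  apply: measurable_ereal_sup_range => i; apply/measurable_EFinP.
  by apply: (measurableT_comp (measurable_powR alpha)); exact: mZ.
have G_ge0 w : 0 <= G w.
  by apply: ereal_sup_ge; exists ((stopped_value Z (tau 0%N) w) `^ alpha)%:E;
    [exists 0%N|rewrite lee_fin powR_ge0].
(* The moment bound makes [G] integrable, and constants are integrable under a probability. *)
have i1G : P.-integrable setT (fun w => 1 + G w).
  apply: integrableD => //.
    exact: finite_measure_integrable_cst.
  apply/integrableP; split=> //.
  under eq_integral do rewrite gee0_abs//.
  by rewrite (le_lt_trans Z_moment) ?ltry.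
pose A K := [set w | tau K w <= T%:E].
have mA K : measurable (A K).
  case: Ffil => _ Fmeas _; apply: (Fmeas T%:E); rewrite ?lee_fin ?ltW//.
  by apply: (tau_stop K).2; rewrite lee_fin ltW.
(* The index is fixed before any [sigma] is introduced, so the error bound is uniform over all
   strategies. *)
have [K0 /= [K0_gt0 K0_tail]] : exists K, (0 < K)%N /\
    \int[P]_(w in A K) (1 + G w) <= eps%:E.
  have : \int[P]_(w in A K) (1 + G w) @[K --> \oo] --> 0.
    apply: integral_vanishing_sets_cvg0 => //.
    apply: filterS tau_lim => w /cvgeyPgt /(_ T); apply: filterS => K TK.
    by rewrite /A/=; apply/negP; rewrite -ltNge.
  move/fine_cvgP => -[fin /cvgr0Pnorm_lt /(_ _ eps_gt0) small].
  have [N _ HN] : \forall K \near \oo, \int[P]_(w in A K) (1 + G w) <= eps%:E.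
    apply: filterS2 fin small => K /= finK /ltW leK.
    by rewrite -(fineK finK) lee_fin (le_trans (ler_norm _)).
  (* The successor makes the index positive and stays beyond the threshold [N]. *)
  by exists N.+1; split=> //; apply: HN => /=.
exists K0; split=> //; split.
  apply: ereal_sup_le => _ [sigma [st sK] <-]; exists sigma => //; split=> //.
  by apply: filterS sK => w [i _ <-]; exists i.
apply: ge_ereal_sup => _ [sigma [st sN] <-].
pose rho w := mine (sigma w) (tau K0 w).
have strho : stopping_time F rho by exact: stopping_time_min.
apply: (@le_trans _ _ ('E_P[stopped_value Z rho] + eps%:E)); last first.
  apply: leeD => //; apply: ereal_sup_ubound; exists rho => //; split=> //.
  apply: filterS2 tau_incr sN => w incr; apply: exercise_times_min => i.
  by case/andP: (incr i).
apply: (@le_trans _ _ ('E_P[stopped_value Z rho] +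
    \int[P]_(w in A K0) (1 + G w))); last by apply: leeD.
have Zst0 s w : stopping_time F s -> (0 <= stopped_value Z s w)%R.
  by move=> sts; apply: stopped_value_ge0 => [t|]; [exact: Z_ge0|exact: sts.1].
have m1G := measurable_int _ i1G.
(* Writing the tail integral over the whole space merges the right-hand side into one integral, so
   that the pathwise inequality applies almost everywhere. *)
rewrite unlock (integral_mkcond (A K0)) -ge0_integralD//; first last.
- apply/(measurable_restrictT _ _).1 => //; exact: measurable_funTS.
- by move=> w _; rewrite /patch; case: ifP => // _; rewrite adde_ge0.
- by apply/measurable_EFinP; exact: mZ.
- by move=> w _; rewrite lee_fin Zst0.
apply: ae_ge0_le_integral => //.
- by move=> w _; rewrite lee_fin Zst0.
- by apply/measurable_EFinP; exact: mZ.
- move=> w _; rewrite adde_ge0// ?lee_fin ?Zst0// /patch; case: ifP => // _.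
  by rewrite adde_ge0.
- apply: emeasurable_funD; first by apply/measurable_EFinP; exact: mZ.
  apply/(measurable_restrictT _ _).1 => //; exact: measurable_funTS.
apply: filterS2 sN Z_after => w sw Zw0 _.
apply: stopped_value_le_min => //; first by move=> i; exact: (tau_stop i).1.
- by move=> t; exact: Z_ge0.
- exact: ltW.
Qed.
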